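(* Let $X=[0,1]^{\mathbb N_0}$ with the shift $\sigma$, let $h\in C^2([0,1]^2;\mathbb R)$ satisfy $D_2D_1h<0$ on $[0,1]^2$, and let $\varphi:X\to\mathbb R$ be given by $\varphi(\underline{x})=h(x_0,x_1)$. Then \[\mathscr{M}_\varphi=\Omega_\varphi=\bigcup_{a\in\mathrm{m}_h}\{a^\infty\}.\]
   Context: $X=[0,1]^{\mathbb N_0}$ carries the metric $d_X(\underline{x},\underline{y})=\sum_{i\ge0}|x_i-y_i|/2^{i+1}$, and $\sigma(\underline{x})_i=x_{i+1}$. For Lipschitz $\varphi:X\to\mathbb R$, $\alpha_\varphi=\inf_\mu\int\varphi\,d\mu$, the infimum over $\sigma$-invariant Borel probability measures; a measure attaining it is called minimizing, and the Mather set $\mathscr{M}_\varphi$ is the union of the supports of all minimizing measures. For $\underline{x},\underline{y}\in X$, $n\in\mathbb N$, $\varepsilon>0$ let $B(\underline{x},\underline{y},n;\varepsilon)=\{\underline{z}\in X: d_X(\underline{x},\underline{z})<\varepsilon,\ d_X(\sigma^n\underline{z},\underline{y})<\varepsilon\}$, $S_\varphi(\underline{x},\underline{y};\varepsilon)=\inf\{\sum_{i=0}^{n-1}(\varphi(\sigma^i\underline{z})-\alpha_\varphi): n\in\mathbb N,\ \underline{z}\in B(\underline{x},\underline{y},n;\varepsilon)\}$ and $S_\varphi(\underline{x},\underline{y})=\lim_{\varepsilon\to0}S_\varphi(\underline{x},\underline{y};\varepsilon)$ (the Mañé potential). The Aubry set is $\Omega_\varphi=\{\underline{x}\in X: S_\varphi(\underline{x},\underline{x})=0\}$.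 For $h:[0,1]^2\to\mathbb R$ continuous, $h^*=\min_{x\in[0,1]}h(x,x)$ and $\mathrm{m}_h=\{a\in[0,1]: h(a,a)=h^*\}$; $a^\infty$ denotes the constant sequence $aaa\ldots$. $D_i$ denotes the partial derivative in the $i$-th variable. *)

(* Defs.v *)
From HB Require Import structures.
From mathcomp Require Import all_boot all_order all_algebra.
From mathcomp Require Import all_classical all_reals all_analysis.
Import Order.TTheory GRing.Theory Num.Theory.
Import numFieldNormedType.Exports.
Set Implicit Arguments.
Unset Strict Implicit.
Unset Printing Implicit Defensive.
Local Open Scope classical_set_scope.
Local Open Scope ring_scope.

Definition X (R : realType) := {x : nat -> R | forall i, 0 <= x i <= 1}.
HB.instance Definition _ (R : realType) := gen_eqMixin (X R).
HB.instance Definition _ (R : realType) := gen_choiceMixin (X R).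
Lemma X0P (R : realType) : forall i : nat, (0:R) <= (fun _ : nat => (0:R)) i <= 1.
Proof. by move=> i /=; rewrite lexx ler01. Qed.
HB.instance Definition _ (R : realType) :=
  isPointed.Build (X R) (exist _ _ (X0P R)).

Section Defs.
Context {R : realType}.

Definition shift (x : X R) : X R :=
  @exist (nat -> R) (fun y => forall i, 0 <= y i <= 1)
    (fun i => proj1_sig x i.+1) (fun i => proj2_sig x i.+1).

Definition dX (x y : X R) : R :=
  limn (fun n => \sum_(0 <= i < n) (`|proj1_sig x i - proj1_sig y i| / 2 ^+ i.+1)).

Definition X_open (U : set (X R)) : Prop :=
  forall x, U x -> exists2 e : R, 0 < e & [set y | dX x y < e] `<=` U.

Definition XB := g_sigma_algebraType X_open.

Definition invariant (mu : probability XB R) : Prop :=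
  forall A : set XB, measurable A -> mu (shift @^-1` A) = mu A.

Variable h : R -> R -> R.

Definition phi (x : X R) : R := h (proj1_sig x 0%N) (proj1_sig x 1%N).

Definition alpha : \bar R :=
  ereal_inf [set (\int[mu]_x (phi x)%:E)%E | mu in [set mu | invariant mu]].

Definition minimizing (mu : probability XB R) : Prop :=
  invariant mu /\ (\int[mu]_x (phi x)%:E)%E = alpha.

Definition support (mu : probability XB R) : set (X R) :=
  [set x | forall e : R, 0 < e -> (0 < mu [set y : XB | (dX x y < e)%R])%E].

Definition Mather : set (X R) :=
  [set x | exists mu : probability XB R, minimizing mu /\ support mu x].

Definition Bset (x y : X R) (n : nat) (e : R) : set (X R) :=
  [set z | dX x z < e /\ dX (iter n shift z) y < e].

Definition S_eps (x y : X R) (e : R) : \bar R :=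
  ereal_inf [set r | exists n : nat, exists z : X R,
    [/\ (0 < n)%N, Bset x y n e z &
        r = (\sum_(i < n) (phi (iter i shift z) - fine alpha))%:E]].

Definition Mane (x y : X R) : \bar R :=
  lim (S_eps x y e @[e --> 0^'+]).

Definition Aubry : set (X R) := [set x | Mane x x = 0%E].

Definition hstar : R := inf [set h x x | x in `[0, 1]].
Definition mh : set R := [set a | 0 <= a <= 1 /\ h a a = hstar].

End Defs.

Definition D1 {R : realType} (h : R -> R -> R) : R -> R -> R :=
  fun x y => derive1 (fun t => h t y) x.
Definition D2 {R : realType} (h : R -> R -> R) : R -> R -> R :=
  fun x y => derive1 (fun s => h x s) y.

Definition partials_exist {R : realType} (f : R -> R -> R) (p : R * R) : Prop :=
  derivable (fun t => f t p.2) p.1 1 /\ derivable (fun s => f p.1 s) p.2 1.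

Definition cont2 {R : realType} (f : R -> R -> R) (p : R * R) : Prop :=
  {for p, continuous (fun q : R * R => f q.1 q.2)}.

Definition C2_on {R : realType} (U : set (R * R)) (h : R -> R -> R) : Prop :=
  forall p, U p ->
    [/\ partials_exist h p, partials_exist (D1 h) p, partials_exist (D2 h) p &
     [/\ cont2 h p, cont2 (D1 h) p, cont2 (D2 h) p, cont2 (D1 (D1 h)) p &
         [/\ cont2 (D2 (D1 h)) p, cont2 (D1 (D2 h)) p & cont2 (D2 (D2 h)) p]]].

Definition unit_square {R : realType} : set (R * R) :=
  [set p | 0 <= p.1 <= 1 /\ 0 <= p.2 <= 1].

(* Main.v *)
Require Import Defs.
From HB Require Import structures.
From mathcomp Require Import all_boot all_order all_algebra.
From mathcomp Require Import all_classical all_reals all_analysis.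
From mathcomp Require Import measurable_realfun lra.
(* Reimported because the libraries above shadow [shift] and [invariant]. *)
Import Defs.
Import Order.TTheory GRing.Theory Num.Theory.
Import numFieldNormedType.Exports.
Local Open Scope classical_set_scope.
Local Open Scope ring_scope.

(** Let [v' s = - D1 h s s] on [[0, 1]]. As [D1 h x] is decreasing,
    [x |-> h x y + v x] has its strict minimum at [x = y], so that
    [h x y - hstar = excess (x, y) + v y - v x] where [excess >= 0] vanishes
    exactly when [x = y] lies in [mh]. The coboundary [v y - v x] integrates to
    [0] against an invariant measure and telescopes along orbits. Hence
    [alpha = hstar], and [excess] vanishes along the whole orbit of a point in
    the support of a minimizing measure, as well as, by an almost-return
    argument, along that of a point of the Aubry set. *)

(** * The metric and Borel structure of the sequence space *)

Section SequenceSpace.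
Context {R : realType}.
Implicit Types x y z : X R.

Local Notation term x y :=
  (fun i => `|proj1_sig x i - proj1_sig y i| / 2 ^+ i.+1 : R).

Lemma dX_term_ge0 x y i : 0 <= term x y i.
Proof. by rewrite divr_ge0 ?exprn_ge0. Qed.

(** Coordinates differ by at most 1, so a geometric series dominates; the [limn] in [dX] is thus a
    genuine limit. *)
Lemma dX_cvg x y : cvgn (series (term x y)).
Proof.
have /cvgP := @cvg_geometric_series_half R 1 0.
apply: series_le_cvg => n; first exact: dX_term_ge0.
- by rewrite divr_ge0.
- rewrite addn1 natrX ler_pM2r ?invr_gt0 ?exprn_gt0//.
  have := proj2_sig x n; have := proj2_sig y n => /= hy hx.
  by rewrite ler_norml; lra.
Qed.

Lemma dX_series_le x y n : series (term x y) n <= dX x y.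
Proof.
apply: (nondecreasing_cvgn_le _ (dX_cvg x y)).
by apply: nondecreasing_series => i _ _; exact: dX_term_ge0.
Qed.

Lemma dX_ge0 x y : 0 <= dX x y.
Proof. by have := dX_series_le x y 0; rewrite /series/= big_nil. Qed.

Lemma coord_dist_le x y i :
  `|proj1_sig x i - proj1_sig y i| <= 2 ^+ i.+1 * dX x y.
Proof.
rewrite -ler_pdivrMl ?exprn_gt0// mulrC.
apply: le_trans (dX_series_le x y i.+1).
rewrite /series/= big_nat_recr//= lerDr.
by apply: sumr_ge0 => j _; exact: dX_term_ge0.
Qed.

Lemma dX_le x y (c : R) : (forall n, series (term x y) n <= c) -> dX x y <= c.
Proof. by move=> H; apply: limr_le; [exact: dX_cvg|exact: nearW]. Qed.

Lemma dXxx x : dX x x = 0.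
Proof.
apply/eqP; rewrite eq_le dX_ge0 andbT; apply: dX_le => n.
by rewrite /series/= big1// => i _; rewrite subrr normr0 mul0r.
Qed.

Lemma dX_sym x y : dX x y = dX y x.
Proof.
by rewrite /dX; congr (lim (_ @ \oo)); apply/funext => n;
  apply: eq_bigr => i _; rewrite distrC.
Qed.

Lemma dX_triangle x y z : dX x z <= dX x y + dX y z.
Proof.
apply: dX_le => n.
apply: (@le_trans _ _ (series (term x y) n + series (term y z) n)).
  rewrite /series/= -big_split/=; apply: ler_sum => i _.
  by rewrite -mulrDl ler_pM2r ?invr_gt0 ?exprn_gt0// ler_distD.
by rewrite lerD// dX_series_le.
Qed.

(** Shifting drops the first term and doubles the weight of every other one. *)
Lemma dX_shift x y : dX (shift x) (shift y) <= 2 * dX x y.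
Proof.
apply: dX_le => n; rewrite -ler_pdivrMl//.
apply: le_trans (dX_series_le x y n.+1).
rewrite /series/= big_nat_recl//= mulr_sumr.
rewrite -[leLHS]add0r; apply: lerD; first exact: dX_term_ge0.
apply: ler_sum => i _; rewrite [in leRHS]exprS invfM.
by rewrite mulrCA.
Qed.

Lemma iter_shiftE n x i : proj1_sig (iter n shift x) i = proj1_sig x (n + i)%N.
Proof. by elim: n i => //= n IH i; rewrite IH addnS. Qed.

Lemma X_openB x (e : R) : X_open [set y | dX x y < e].
Proof.
move=> y /= xy; exists (e - dX x y); first by rewrite subr_gt0.
move=> z /= yz; apply: le_lt_trans (dX_triangle x y z) _; lra.
Qed.

Lemma X_open_measurable (U : set (X R)) : X_open U -> measurable (U : set XB).
Proof. by move=> oU; apply: sub_sigma_algebra. Qed.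

Lemma measurable_ballX x (e : R) : measurable ([set y | dX x y < e] : set XB).
Proof. by apply: X_open_measurable; exact: X_openB. Qed.

Definition continuousX (f : X R -> R) := forall x (e : R), 0 < e ->
  exists2 d : R, 0 < d & forall y, dX x y < d -> `|f x - f y| < e.

(** The rays []a, +oo[] generate the Borel sets of the line, and their preimages are open for
    [dX]. *)
Lemma continuousX_measurable (f : XB -> R) :
  continuousX f -> measurable_fun setT f.
Proof.
move=> cf; apply: (measurability _ (RGenOInfty.measurableE R)).
move=> _ [_ [a ->] <-]; rewrite setTI; apply: X_open_measurable => x /=.
rewrite in_itv/= andbT => afx.
have [|d d0 H] := cf x (f x - a); first by rewrite subr_gt0.
exists d => // y /= /H; rewrite in_itv/= andbT ltr_norml => /andP[_]; lra.
Qed.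

Lemma shift_measurable : measurable_fun setT (shift : XB -> XB (R := R)).
Proof.
have mE : @measurable _ (XB (R := R)) = <<s @X_open R >> by [].
apply: (measurability _ mE) => _ [U oU <-].
rewrite setTI.
apply: X_open_measurable => x /= /oU[e e0 He].
exists (e / 2); first by rewrite divr_gt0.
move=> y /= xy; apply: He => /=.
by apply: le_lt_trans (dX_shift x y) _; lra.
Qed.

(** The weight of the larger index in [coord_dist_le] controls both coordinates at once. *)
Lemma continuousX_coord2 (g : R * R -> R) i j :
  (forall p, unit_square p -> {for p, continuous g}) ->
  continuousX (fun x => g (proj1_sig x i, proj1_sig x j)).
Proof.
move=> cg x e e0.
have /cg/cvgrPdist_lt/(_ _ e0) : unit_square (proj1_sig x i, proj1_sig x j).
  by split=> /=; [exact: (proj2_sig x i)|exact: (proj2_sig x j)].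
rewrite near_nbhs => /nbhs_ballP[d /= d0 Hd].
have coord_lt k (y : X R) : dX x y < d / 2 ^+ (maxn i j).+1 -> (k <= maxn i j)%N ->
    `|proj1_sig x k - proj1_sig y k| < d.
  move=> xy kij; apply: le_lt_trans (coord_dist_le x y k) _.
  apply: (@le_lt_trans _ _ (2 ^+ (maxn i j).+1 * dX x y)).
    by rewrite ler_wpM2r ?dX_ge0// ler_weXn2l// ler1n.
  by rewrite -ltr_pdivlMl ?exprn_gt0// mulrC.
exists (d / 2 ^+ (maxn i j).+1); first by rewrite divr_gt0 ?exprn_gt0.
move=> y xy; apply: Hd; split=> /=; apply: coord_lt => //.
- exact: leq_maxl.
- exact: leq_maxr.
Qed.

End SequenceSpace.

(** * The potential *)

Section Potential.
Context {R : realType}.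

(** The retraction of the line onto the unit interval, in a closed form whose continuity follows
    from that of the norm. *)
Let clamp (s : R) : R := (`|s| - `|s - 1| + 1) / 2.

Let clamp_id (s : R) : 0 <= s <= 1 -> clamp s = s.
Proof. by move=> s01; rewrite /clamp ger0_norm ?ler0_norm; lra. Qed.

Let clamp01 s : 0 <= clamp s <= 1.
Proof.
rewrite /clamp; have [] := ger0P s; have [] := ger0P (s - 1); lra.
Qed.

Let clamp_continuous : continuous clamp.
Proof.
move=> s; apply: cvgMl; apply: cvgD; last exact: cvg_cst.
apply: cvgB; first by apply: cvg_norm; exact: cvg_id.
by apply: cvg_norm; apply: cvgB; [exact: cvg_id|exact: cvg_cst].
Qed.

(** Composing with [clamp] extends [f] continuously to the whole line. Integrating over [[-1, 2]]
    makes 0 and 1 interior points, so that the derivative is two-sided there as well. *)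
Lemma exists_antiderivative01 (f : R -> R) :
  (forall s : R, 0 <= s <= 1 -> {for s, continuous f}) ->
  exists v : R -> R, forall s : R, 0 <= s <= 1 ->
    derivable v s 1 /\ derive1 v s = f s.
Proof.
move=> cf; pose g := f \o clamp.
have cg : continuous g.
  move=> s; apply: continuous_comp; first exact: clamp_continuous.
  by apply: cf; exact: clamp01.
have gi : (@lebesgue_measure R).-integrable `[(-1)%R, 2%R] (EFin \o g).
  apply: continuous_compact_integrable; first exact: segment_compact.
  exact: continuous_subspaceT.
exists (fun x => \int[lebesgue_measure]_(t in `[-1, x]) g t) => s s01.
have [||d ->] := continuous_FTC1_closed _ gi _ (cg s); try lra.
by split=> //; rewrite /g/= clamp_id.
Qed.

(* [v] is an antiderivative of [- D1 h] along the diagonal: since [D1 h x] is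
   decreasing, [h x y + v x] decreases for [x < y] and increases for [x > y]. *)
Lemma exists_potential (h : R -> R -> R) (U : set (R * R)) :
  unit_square `<=` U -> C2_on U h ->
  (forall x y : R, 0 <= x <= 1 -> 0 <= y <= 1 -> D2 (D1 h) x y < 0) ->
  exists v : R -> R, (forall x : R, 0 <= x <= 1 -> {for x, continuous v}) /\
    forall x y : R, 0 <= x <= 1 -> 0 <= y <= 1 -> x != y ->
      h y y + v y < h x y + v x.
Proof.
move=> subU C2 D21_lt0.
have C2sq (x y : R) : 0 <= x <= 1 -> 0 <= y <= 1 ->
  [/\ derivable (fun t => h t y) x 1, derivable (D1 h x) y 1 &
      cont2 (D1 h) (x, y)].
  move=> x01 y01; have [[dh _] [_ dD1] _ [_ cD1 _ _ _]] :=
    C2 (x, y) (subU (x, y) (conj x01 y01)).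
  by split; [exact: dh|exact: dD1|exact: cD1].
have D1_decr (x y z : R) : 0 <= x <= 1 -> 0 <= y -> y < z -> z <= 1 ->
    D1 h x z < D1 h x y.
  move=> x01 y0 yz z1.
  apply: (@ltr0_derive1_decr _ _ 0 1) => //.
  - move=> t; rewrite in_itv/= => t01.
    by have [|_ d _] := C2sq x t x01; [lra|exact: d].
  - by move=> t; rewrite in_itv/= => t01; apply: D21_lt0 => //; lra.
  - apply: derivable_within_continuous => t; rewrite in_itv/= => t01.
    by have [_ d _] := C2sq x t x01 t01; exact: d.
have [|v v'] := @exists_antiderivative01 (fun s => - D1 h s s).
  move=> s s01; apply: cvgN; have [_ _ cD] := C2sq s s s01 s01.
  apply: (@continuous_comp _ _ _ (fun s : R => (s, s)) (fun q => D1 h q.1 q.2)) => //.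
  exact: (cvg_pair (@cvg_id _ (nbhs s)) (@cvg_id _ (nbhs s))).
exists v; split=> [x /v'[dv _]|x y x01 y01 xy].
  exact/differentiable_continuous/derivable1_diffP.
pose F t := h t y + v t.
have dF (t : R) : 0 <= t <= 1 -> derivable F t 1.
  move=> t01; have [dh _ _] := C2sq t y t01 y01; have [dv _] := v' t t01.
  exact: derivableD.
have F' (t : R) : 0 <= t <= 1 -> derive1 F t = D1 h t y - D1 h t t.
  move=> t01; have [dh _ _] := C2sq t y t01 y01; have [dv dvE] := v' t t01.
  by rewrite derive1E deriveD// -!derive1E dvE.
have cF (a b : R) : 0 <= a -> b <= 1 -> {within `[a, b], continuous F}.
  move=> a0 b1; apply: derivable_within_continuous => t; rewrite in_itv/= => tab.
  by apply: dF; lra.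
have [yx|xy'|xyE] := ltgtP x y; last by rewrite xyE eqxx in xy.
- apply: (@ltr0_derive1_decr _ F x y) => //.
  + by move=> t; rewrite in_itv/= => txy; apply: dF; lra.
  + move=> t; rewrite in_itv/= => txy; rewrite F'; last lra.
    by rewrite subr_lt0; apply: D1_decr; lra.
  + by apply: cF; lra.
- apply: (@gtr0_derive1_incr _ F y x) => //.
  + by move=> t; rewrite in_itv/= => txy; apply: dF; lra.
  + move=> t; rewrite in_itv/= => txy; rewrite F'; last lra.
    by rewrite subr_gt0; apply: D1_decr; lra.
  + by apply: cF; lra.
Qed.
End Potential.

(** * Invariant measures *)

Section InvariantMeasures.
Context {R : realType}.
Implicit Types (mu : probability (XB (R := R)) R) (x : X R).

Lemma bounded_unit_square (g : R * R -> R) :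
  (forall p, unit_square p -> {for p, continuous g}) ->
  exists M : R, forall p, unit_square p -> `|g p| <= M.
Proof.
move=> cg.
have cK : compact (`[0%R, 1%R] `*` `[0%R, 1%R] : set (R * R)).
  by apply: compact_setX; exact: segment_compact.
have /compact_bounded[M [_ HM]] : compact (g @` (`[0%R, 1%R] `*` `[0%R, 1%R])).
  apply: continuous_compact => //; apply: continuous_in_subspaceT => p.
  by rewrite inE => -[] /=; rewrite !in_itv/= => p1 p2; apply: cg; split.
exists (M + 1) => p [p1 p2]; apply: (HM (M + 1)); first by rewrite ltrDl.
by exists p => //; split; rewrite /= in_itv.
Qed.

Lemma integrable_coord2 mu (g : R * R -> R) i j :
  (forall p, unit_square p -> {for p, continuous g}) ->
  mu.-integrable setT (fun x => (g (proj1_sig x i, proj1_sig x j))%:E).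
Proof.
move=> cg; have [M HM] := bounded_unit_square g cg.
apply: (@measurable_bounded_integrable _ _ _ mu
  (fun x => g (proj1_sig x i, proj1_sig x j))) => //.
- exact: (le_lt_trans (probability_le1 mu measurableT) (ltry _)).
- by apply: continuousX_measurable; exact: continuousX_coord2.
- exists M; split; first exact: num_real.
  move=> N MN x _; apply: le_trans (ltW MN); apply: HM.
  by split=> /=; [exact: (proj2_sig x i)|exact: (proj2_sig x j)].
Qed.

(** Change of variables: by invariance, the image of [mu] under the shift is [mu] itself. *)
Lemma integral_shift mu (f : XB -> R) : invariant mu ->
  measurable_fun setT f -> mu.-integrable setT (fun x => (f (shift x))%:E) ->
  (\int[mu]_x (f (shift x))%:E = \int[mu]_x (f x)%:E)%E.
Proof.
move=> inv mf intf.
have := @integral_pushforward _ _ _ _ R _ shift_measurable mu setT (EFin \o f) _ _ _.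
rewrite preimage_setT => <- //; last exact/measurable_EFinP.
apply: eq_measure_integral => [|? A mA _]; first exact: shift_measurable.
exact: inv.
Qed.

(** By [dX_shift], the ball of radius [e / 2] about [x] lies in the preimage of the ball of radius
    [e] about its shift. *)
Lemma support_shift mu x : invariant mu ->
  Defs.support mu x -> Defs.support mu (shift x).
Proof.
move=> inv sx e e0; rewrite -inv; last exact: measurable_ballX.
apply: lt_le_trans (sx (e / 2) _) _; first by rewrite divr_gt0.
apply: le_measure; rewrite ?inE.
- exact: measurable_ballX.
- rewrite -[X in measurable X]setTI; apply: shift_measurable => //.
  exact: measurable_ballX.
- by move=> y /= xy; apply: le_lt_trans (dX_shift x y) _; lra.
Qed.

(** A positive value at a support point would persist, up to a factor 2, on a ball of positive
    measure and make the integral positive. *)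
Lemma integral_eq0_support mu (f : XB -> R) x : continuousX f ->
  (forall y, 0 <= f y) -> (\int[mu]_y (f y)%:E = 0)%E ->
  Defs.support mu x -> f x = 0.
Proof.
move=> cf f0 intf0 sx; apply/eqP; rewrite eq_le f0 andbT leNgt; apply/negP => fx.
have fx2 : 0 < f x / 2 by rewrite divr_gt0.
have [d d0 Hd] := cf x _ fx2.
set B := [set y : XB | dX x y < d].
have mB : measurable B by exact: measurable_ballX.
have mf : measurable_fun setT (EFin \o f).
  by apply/measurable_EFinP; exact: continuousX_measurable.
have : (0 < (f x / 2)%:E * mu B)%E by rewrite mule_gt0 ?lte_fin//; exact: sx.
apply/negP; rewrite -leNgt -(integral_cst mu mB) -intf0.
apply: le_trans (ge0_subset_integral mu mB measurableT mf _ _) => //; last first.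
  by move=> y _ /=; rewrite lee_fin.
apply: ge0_le_integral => //.
- by move=> y _; rewrite lee_fin ltW.
- exact: measurable_funTS.
- by move=> y /Hd; rewrite /= lee_fin ltr_norml => /andP[_]; lra.
Qed.

Definition const_seq {a : R} (a01 : 0 <= a <= 1) : X R :=
  @exist (nat -> R) (fun u => forall i, 0 <= u i <= 1) (fun=> a) (fun=> a01).

Lemma eqX (x y : X R) : proj1_sig x = proj1_sig y -> x = y.
Proof. by case: x y => [x px] [y py] /= xy; exact: eq_exist. Qed.

Lemma iter_shift_const_seq n (a : R) (a01 : 0 <= a <= 1) :
  iter n shift (const_seq a01) = const_seq a01.
Proof. by elim: n => //= n ->; exact: eqX. Qed.

Lemma invariant_dirac (a : R) (a01 : 0 <= a <= 1) :
  invariant (\d_(const_seq a01 : XB) : probability XB R).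
Proof.
by move=> A _; rewrite /= !diracE.
Qed.

Lemma support_dirac x : Defs.support (\d_(x : XB) : probability XB R) x.
Proof. by move=> e e0; rewrite /= diracE mem_set//= dXxx. Qed.

End InvariantMeasures.

(** * The excess and the minimizing sets *)

(** Shrinking [e] leaves fewer admissible [z], so [S_eps] grows as [e] decreases and its right limit
    at 0 is a supremum. *)
Lemma Mane_sup {R : realType} (h : R -> R -> R) (x y : X R) :
  Mane h x y = ereal_sup [set S_eps h x y e | e in `]0, +oo[].
Proof.
apply: cvg_lim => //; apply: nonincreasing_at_right_cvge => // d e _ _ de.
apply: ereal_inf_le_tmp => _ [n [z [n0 [xz zy] ->]]].
by exists n, z; split=> //; split; exact: lt_le_trans de.
Qed.

Section Excess.
Context {R : realType} (h : R -> R -> R) (v : R -> R).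
Context (h_cont : forall p, unit_square p -> cont2 h p).
Context (v_cont : forall x : R, 0 <= x <= 1 -> {for x, continuous v}).
Context (h_twist : forall x y : R, 0 <= x <= 1 -> 0 <= y <= 1 -> x != y ->
  h y y + v y < h x y + v x).

Definition excess (p : R * R) : R := h p.1 p.2 - hstar h - v p.2 + v p.1.

Lemma v_fst_continuous p : unit_square p ->
  {for p, continuous (fun q : R * R => v q.1)}.
Proof.
move=> [p1 _]; apply: (@continuous_comp _ _ _ fst v p); first exact: cvg_fst.
exact: v_cont.
Qed.

Lemma v_snd_continuous p : unit_square p ->
  {for p, continuous (fun q : R * R => v q.2)}.
Proof.
move=> [_ p2]; apply: (@continuous_comp _ _ _ snd v p); first exact: cvg_snd.
exact: v_cont.
Qed.

Lemma excess_continuous p : unit_square p -> {for p, continuous excess}.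
Proof.
move=> p01; apply: cvgD; last exact: v_fst_continuous.
apply: cvgB; last exact: v_snd_continuous.
by apply: cvgB; [exact: h_cont|exact: cvg_cst].
Qed.

Lemma hstar_le (a : R) : 0 <= a <= 1 -> hstar h <= h a a.
Proof.
move=> a01; apply: ge_inf; last by exists a => //=; rewrite in_itv.
(* [ge_inf] needs the diagonal values to be bounded below, which compactness of the square
   supplies. *)
have [M HM] := bounded_unit_square (fun q => h q.1 q.2) h_cont.
exists (- M) => _ [t /= + <-]; rewrite in_itv/= => t01.
by have /HM : unit_square (t, t) by []; rewrite ler_norml => /andP[].
Qed.

(** The excess is the sum of the strict gap in [h_twist] and of the nonnegative gap
    [h y y - hstar h]. *)
Lemma excess_gt0 (x y : R) : 0 <= x <= 1 -> 0 <= y <= 1 -> x != y ->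
  0 < excess (x, y).
Proof.
move=> x01 y01 xy; rewrite /excess/=.
have := hstar_le y y01; have := h_twist x y x01 y01 xy; lra.
Qed.

Lemma excess_ge0 p : unit_square p -> 0 <= excess p.
Proof.
case: p => x y [/= x01 y01]; have [->|xy] := eqVneq x y.
  by rewrite /excess/=; have := hstar_le y y01; lra.
exact/ltW/excess_gt0.
Qed.

Lemma excess_eq0 (x y : R) : 0 <= x <= 1 -> 0 <= y <= 1 ->
  excess (x, y) = 0 -> x = y /\ mh h x.
Proof.
move=> x01 y01 e0; have [xy|xy] := eqVneq x y; last first.
  by have := excess_gt0 x y x01 y01 xy; rewrite e0 ltxx.
by split=> //; split=> //; move: e0; rewrite /excess -xy/=; lra.
Qed.

Definition excessX i (x : X R) : R := excess (proj1_sig x i, proj1_sig x i.+1).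

Lemma unit_square_coord (x : X R) i j :
  unit_square (proj1_sig x i, proj1_sig x j).
Proof. by split=> /=; [exact: (proj2_sig x i)|exact: (proj2_sig x j)]. Qed.

Lemma excessX_ge0 i x : 0 <= excessX i x.
Proof. by apply: excess_ge0; exact: unit_square_coord. Qed.

Lemma excessX_continuous i : continuousX (excessX i).
Proof. by apply: continuousX_coord2; exact: excess_continuous. Qed.

Lemma excessX_eq0 i x : excessX i x = 0 ->
  proj1_sig x i = proj1_sig x i.+1 /\ mh h (proj1_sig x i).
Proof.
by apply: excess_eq0; [exact: (proj2_sig x i)|exact: (proj2_sig x i.+1)].
Qed.

(** * Orbit sums, invariant integrals and the minimal mean *)

Lemma sum_phi n (z : X R) :
  \sum_(i < n) (phi h (iter i shift z) - hstar h) =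
  \sum_(i < n) excessX i z + v (proj1_sig z n) - v (proj1_sig z 0%N).
Proof.
elim: n => [|n IH]; first by rewrite !big_ord0; lra.
rewrite !big_ord_recr/= IH /phi !iter_shiftE addn0 addn1 /excessX/excess/=.
lra.
Qed.

(** The coboundary drops out: by invariance, [v] has the same integral when read at coordinate 0 and
    at coordinate 1. *)
Lemma integral_phi (mu : probability (XB (R := R)) R) : invariant mu ->
  (\int[mu]_x (phi h x)%:E = (hstar h)%:E + \int[mu]_x (excessX 0 x)%:E)%E.
Proof.
move=> inv.
have iphi : mu.-integrable setT (fun x : XB => (phi h x)%:E).
  exact: (integrable_coord2 mu (fun q => h q.1 q.2) 0 1 h_cont).
have iv0 : mu.-integrable setT (fun x : XB => (v (proj1_sig x 0%N))%:E).
  exact: (integrable_coord2 mu (fun q => v q.1) 0 1 v_fst_continuous).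
have iv1 : mu.-integrable setT (fun x : XB => (v (proj1_sig x 1%N))%:E).
  exact: (integrable_coord2 mu (fun q => v q.2) 0 1 v_snd_continuous).
have ie : mu.-integrable setT (fun x : XB => (excessX 0 x)%:E).
  exact: (integrable_coord2 mu excess 0 1 excess_continuous).
have mv0 : measurable_fun setT (fun x : XB => v (proj1_sig x 0%N)).
  apply: continuousX_measurable.
  exact: (continuousX_coord2 (fun q => v q.1) 0 1 v_fst_continuous).
have v01 := @integral_shift R mu _ inv mv0 iv1.
have ic : mu.-integrable setT (fun x : XB => (hstar h)%:E).
  exact: (integrable_coord2 mu (fun=> hstar h) 0 1 (fun _ _ => @cvg_cst _ _ _ _ _)).
transitivity (\int[mu]_x ((hstar h)%:E + (excessX 0 x)%:E +
    ((v (proj1_sig (shift x) 0%N))%:E - (v (proj1_sig x 0%N))%:E)))%E.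
  apply: eq_integral => x _; rewrite -EFinB -!EFinD; congr EFin.
  by rewrite /phi/excessX/excess/=; lra.
rewrite integralD//; [|exact: integrableD|exact: integrableB].
rewrite integralD// integralB// v01 subee ?adde0; last first.
  exact: integrable_fin_num.
congr (_ + _)%E; rewrite (integral_cst mu measurableT).
rewrite -[RHS]mule1; congr (_ * _)%E; exact: probability_setT.
Qed.

Lemma integral_phi_dirac (a : R) (a01 : 0 <= a <= 1) :
  (\int[(\d_(const_seq a01 : XB) : probability XB R)]_x (phi h x)%:E =
   (h a a)%:E)%E.
Proof.
rewrite integral_dirac//; first by rewrite diracT mul1e.
apply/measurable_EFinP; apply: continuousX_measurable.
exact: (continuousX_coord2 (fun q => h q.1 q.2) 0 1 h_cont).
Qed.

(** Nonnegativity of the excess bounds every invariant integral from below, while Dirac masses at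
    constant sequences realise each diagonal value [h a a]. *)
Lemma alpha_hstar : alpha h = (hstar h)%:E.
Proof.
apply/eqP; rewrite eq_le; apply/andP; split; last first.
  apply: le_ereal_inf_tmp => _ [mu inv <-]; rewrite integral_phi// leeDl//.
  by apply: integral_ge0 => x _; rewrite lee_fin excessX_ge0.
have alpha_le (a : R) : 0 <= a <= 1 -> (alpha h <= (h a a)%:E)%E.
  move=> a01; apply: ereal_inf_lbound.
  exists (\d_(const_seq a01 : XB)); first exact: invariant_dirac.
  exact: integral_phi_dirac.
(* The bound at 0 excludes [+oo], and [-oo] lies below [hstar h] anyway, so the comparison of infima
   is left for a finite value only. *)
have fa : alpha h \is a fin_num \/ alpha h = -oo%E.
  have := alpha_le 0; case: (alpha h) => [r _|H|_]; [by left| |by right].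
  by have := H ltac:(lra).
case: fa => [fa|->]; last by rewrite leNye.
rewrite -(fineK fa) lee_fin; apply: lb_le_inf.
  by exists (h 0 0), 0 => //=; rewrite in_itv/= lexx ler01.
move=> _ [t /= + <-]; rewrite in_itv/= => t01.
by rewrite -lee_fin fineK//; exact: alpha_le.
Qed.

(** * The Mather set *)

Lemma Mather_sub (x : X R) : Mather h x ->
  exists a : R, mh h a /\ proj1_sig x = (fun=> a).
Proof.
move=> [mu [[inv muE] sx]].
(* [integral_phi] and [alpha_hstar] evaluate the same integral, which forces the excess part to
   vanish. *)
have int0 : (\int[mu]_y (excessX 0 y)%:E = 0)%E.
  move: muE; rewrite alpha_hstar integral_phi//.
  move: (\int[mu]_y _)%E => [r| |]//=; rewrite -EFinD => -[] /eqP.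
  by rewrite addrC -subr_eq0 addrK => /eqP ->.
(* The whole orbit stays in the support, which carries the vanishing of the excess from coordinates
   0 and 1 to every consecutive pair. *)
have sxi i : Defs.support mu (iter i shift x).
  by elim: i => //= i; exact: support_shift.
have e0 i : excessX i x = 0.
  have := integral_eq0_support mu _ (iter i shift x)
    (excessX_continuous 0) (excessX_ge0 0) int0 (sxi i).
  by rewrite /excessX !iter_shiftE addn0 addn1.
exists (proj1_sig x 0%N); split; first by have [] := excessX_eq0 _ _ (e0 0%N).
apply/funext; elim=> // i IH.
by have [<-] := excessX_eq0 _ _ (e0 i).
Qed.

Lemma Mather_const_seq (a : R) (a01 : 0 <= a <= 1) :
  mh h a -> Mather h (const_seq a01).
Proof.
move=> [_ ha]; exists (\d_(const_seq a01 : XB)); split; last exact: support_dirac.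
split; first exact: invariant_dirac.
by rewrite integral_phi_dirac alpha_hstar ha.
Qed.

(** * The Aubry set *)

Lemma v_near (x : X R) (eta : R) : 0 < eta -> exists2 d : R, 0 < d &
  forall z : X R, dX x z < d ->
    `|v (proj1_sig x 0%N) - v (proj1_sig z 0%N)| < eta.
Proof.
exact: (continuousX_coord2 (fun q => v q.1) 0 1 v_fst_continuous).
Qed.

(** The fixed point is a loop of length 1 and cost 0, which gives the upper bound. For the lower
    one, an almost-loop costs at least the increment of [v] between its ends, which is small when
    both are near [x]. *)
Lemma Aubry_const_seq (a : R) (a01 : 0 <= a <= 1) :
  mh h a -> Aubry h (const_seq a01).
Proof.
move=> [_ ha]; rewrite /Aubry/= Mane_sup; set x := const_seq a01.
apply/eqP; rewrite eq_le; apply/andP; split.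
  apply: ge_ereal_sup => _ [e /= + <-]; rewrite in_itv/= andbT => e0.
  apply: ereal_inf_lbound; exists 1%N, x; split=> //.
    by split; rewrite ?iter_shift_const_seq dXxx.
  by rewrite big_ord1/= alpha_hstar/= /phi/= ha subrr.
apply/lee_addgt0Pr => eta eta0.
have [d d0 Hd] := v_near x (eta / 2) ltac:(by rewrite divr_gt0).
apply: (@le_trans _ _ (S_eps h x x d + eta%:E)%E); last first.
  rewrite leeD2r//; apply: ereal_sup_ubound.
  by exists d => //=; rewrite in_itv/= andbT.
rewrite -leeBlDr// sub0e; apply: le_ereal_inf_tmp => _ [n [z [n0 [xz zx] ->]]].
rewrite alpha_hstar/= sum_phi lee_fin.
have : 0 <= \sum_(i < n) excessX i z by apply: sumr_ge0 => i _; exact: excessX_ge0.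
have := Hd z xz; rewrite dX_sym in zx; have := Hd _ zx.
rewrite iter_shiftE addn0 !ltr_norml => /andP[? ?] /andP[? ?] ?; lra.
Qed.

(** As the supremum is 0, almost-loops of cost below [eta / 3] exist at every scale. Each end
    changes [v] by less than [eta / 3], so the total excess, and with it each of its nonnegative
    terms, is below [eta]. *)
Lemma Aubry_almost_return (x : X R) (eta : R) : Aubry h x -> 0 < eta ->
  exists n, exists z, [/\ (0 < n)%N, dX x z < eta, dX (iter n shift z) x < eta &
    forall i, (i < n)%N -> excessX i z < eta].
Proof.
rewrite /Aubry/= Mane_sup => sup0 eta0.
have eta3 : 0 < eta / 3 by rewrite divr_gt0.
have [d d0 Hd] := v_near x (eta / 3) eta3.
have e0 : 0 < Num.min eta d by rewrite lt_min eta0.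
have : (S_eps h x x (Num.min eta d) < (eta / 3)%:E)%E.
  apply: (@le_lt_trans _ _ 0%E); last by rewrite lte_fin.
  rewrite -sup0; apply: ereal_sup_ubound.
  by exists (Num.min eta d) => //=; rewrite in_itv/= andbT.
move=> /ereal_inf_lt[_ [n [z [n0 [xz zx] ->]]]].
rewrite alpha_hstar/= sum_phi lte_fin => sum_lt.
move: xz zx; rewrite !lt_min => /andP[xz xz'] /andP[zx zx'].
exists n, z; split=> // i ilt.
apply: (@le_lt_trans _ _ (\sum_(i < n) excessX i z)).
  rewrite (bigD1 (Ordinal ilt))//= lerDl.
  by apply: sumr_ge0 => j _; exact: excessX_ge0.
have := Hd z xz'; rewrite dX_sym in zx'; have := Hd _ zx'.
rewrite iter_shiftE addn0 !ltr_norml => /andP[? ?] /andP[? ?]; lra.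
Qed.

(* Almost returns [z] of length [n > k] force [excessX k x = 0]; if only
   [n <= k] occurs then [x k.+1] is close to [z k.+1], hence to the earlier
   coordinate [x (k.+1 - n)]. *)
Lemma Aubry_step (x : X R) k : Aubry h x -> 0 < excessX k x ->
  (forall j, (j <= k)%N -> proj1_sig x j = proj1_sig x 0%N) ->
  (0 < k)%N /\ proj1_sig x k.+1 = proj1_sig x 0%N.
Proof.
move=> Ax ek xk.
have ek2 : 0 < excessX k x / 2 by rewrite divr_gt0.
have [d d0 Hd] := excessX_continuous k x _ ek2.
pose e0 := Num.min d (excessX k x / 2).
have e0_gt0 : 0 < e0 by rewrite lt_min d0.
have ret eta : 0 < eta -> eta <= e0 -> exists n, exists z,
    [/\ (0 < n)%N, (n <= k)%N, dX x z < eta & dX (iter n shift z) x < eta].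
  move=> eta0; rewrite le_min => /andP[etad etae].
  have [n [z [n0 xz zx exc]]] := Aubry_almost_return x eta Ax eta0.
  (* If [k < n], the return puts [excessX k z] below half of [excessX k x], while continuity at [x]
     keeps it above that half. *)
  exists n, z; split=> //; rewrite leqNgt; apply/negP => /exc.
  have := Hd z (lt_le_trans xz etad); rewrite ltr_norml => /andP[_]; lra.
split.
  have [n [z [n0 nk _ _]]] := ret e0 e0_gt0 (lexx _); exact: leq_trans nk.
apply/eqP; rewrite -subr_eq0 -normr_le0 leNgt; apply/negP.
set g := `|_| => g0.
(* [c] is the factor lost by [coord_dist_le] at index [k.+1]. With this [eta], both errors in the
   triangle inequality stay below [g / 2], although they should add up to at least [g]. *)
pose c : R := 2 ^+ k.+2; have c0 : 0 < c by rewrite exprn_gt0.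
pose eta := Num.min e0 (g / (2 * c)).
have [||n [z [n0 nk xz zx]]] := ret eta.
- by rewrite lt_min e0_gt0 divr_gt0// mulr_gt0.
- by rewrite ge_min lexx.
have := coord_dist_le x z k.+1.
have := coord_dist_le (iter n shift z) x (k.+1 - n)%N.
(* As [n > 0], the index [k.+1 - n] is at most [k], where [x] still has its initial value. *)
rewrite iter_shiftE subnKC ?(leq_trans nk)// xk; last first.
  by rewrite -ltnS ltn_subrL n0.
have clt w : w < eta -> c * w < g / 2.
  rewrite lt_min => /andP[_]; rewrite -ltr_pdivlMl// invfM mulrA => H.
  by apply: lt_le_trans H _; rewrite mulrC.
have := clt _ xz; have := clt _ zx.
have : 2 ^+ (k.+1 - n).+1 * dX (iter n shift z) x <= c * dX (iter n shift z) x.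
  by rewrite ler_wpM2r ?dX_ge0// ler_weXn2l ?ler1n// ltnS leq_subr.
have : g <= `|proj1_sig x k.+1 - proj1_sig z k.+1| +
            `|proj1_sig z k.+1 - proj1_sig x 0%N| by exact: ler_distD.
rewrite -/c; lra.
Qed.

Lemma Aubry_sub (x : X R) : Aubry h x ->
  exists a : R, mh h a /\ proj1_sig x = (fun=> a).
Proof.
move=> Ax; exists (proj1_sig x 0%N).
have e0 k : excessX k x = 0 \/ 0 < excessX k x.
  by have := excessX_ge0 k x; rewrite le_eqVlt => /predU1P[|]; [left|right].
split.
  have [/excessX_eq0[]//|e_gt0] := e0 0%N.
  (* A positive excess at index 0 would yield [0 < 0]. *)
  by have [] := Aubry_step x 0 Ax e_gt0 ltac:(by move=> [|j]).
(* Strong induction, since [Aubry_step] requires all coordinates up to [j] to agree. *)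
apply/funext => k; elim: k {-2}k (leqnn k) => [|k IH] [|j]// jk.
have [/excessX_eq0[<- _]|e_gt0] := e0 j; first exact: IH.
have [] // := Aubry_step x j Ax e_gt0.
by move=> i ij; apply: IH; exact: leq_trans ij _.
Qed.

End Excess.

Theorem theorem1 (R : realType) (h : R -> R -> R) :
  (exists U : set (R * R), [/\ open U, unit_square `<=` U & C2_on U h]) ->
  (forall x y : R, 0 <= x <= 1 -> 0 <= y <= 1 -> D2 (D1 h) x y < 0) ->
  Mather h = Aubry h /\
  Aubry h = [set x : X R | exists a : R, mh h a /\ proj1_sig x = (fun _ => a)].
Proof.
move=> [U [_ subU C2]] D21_lt0.
have [v [v_cont twist]] := exists_potential h U subU C2 D21_lt0.
have h_cont p : unit_square p -> cont2 h p by move=> /subU/C2[_ _ _ []].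
have AubryE : Aubry h =
    [set x : X R | exists a : R, mh h a /\ proj1_sig x = (fun _ => a)].
  apply/seteqP; split=> [x|x [a [[a01 ha] xa]]].
    exact: Aubry_sub h_cont v_cont twist x.
  rewrite (_ : x = const_seq a01); last exact: eqX.
  exact: Aubry_const_seq h_cont v_cont twist a a01 (conj a01 ha).
split=> //; rewrite AubryE; apply/seteqP; split=> [x|x [a [[a01 ha] xa]]].
  exact: Mather_sub h_cont v_cont twist x.
rewrite (_ : x = const_seq a01); last exact: eqX.
exact: Mather_const_seq h_cont v_cont twist a a01 (conj a01 ha).
Qed.
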